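(* Let $\mathbf{r}: S^1\to\mathbb{R}^2$ be a $C^\infty$ immersion whose no-silhouette $\mathcal{NS}_{\mathbf{r}}$ is non-empty, and let $\theta_{\mathbf{r}}$ be its aperture angle. Then there exists a unique point $P_{\mathbf{r}}\in\mathbb{R}^2$ such that for any sequence $\{\theta_i\}_{i=1,2,\ldots}\subset[0,\theta_{\mathbf{r}})$ satisfying $\lim_{i\to\infty}\theta_i=\theta_{\mathbf{r}}$, the following holds: $$\lim_{i\to\infty}d_H\left(\overline{\mathcal{NS}_{\theta_i,\mathbf{r}}},\,P_{\mathbf{r}}\right)=0,$$ where $P_{\mathbf{r}}$ is identified with the one-point set $\{P_{\mathbf{r}}\}$.
   Context: Let $\mathbf{r}: S^1\to\mathbb{R}^2$ be a $C^\infty$ immersion. For $s\in S^1$, $d\mathbf{r}_s(T_s(S^1))$ is regarded as a one-dimensional linear subspace of $\mathbb{R}^2$ (identifying $T_{\mathbf{r}(s)}\mathbb{R}^2$ with $\mathbb{R}^2$), so that $\mathbf{r}(s)+d\mathbf{r}_s(T_s(S^1))$ is the affine tangent line at $\mathbf{r}(s)$. For a real number $\theta$, let $R_\theta:\mathbb{R}^2\to\mathbb{R}^2$ be the rotation $R_\theta(x,y)=(x\cos\theta-y\sin\theta,\ x\sin\theta+y\cos\theta)$ and define $$\mathcal{NS}_{\theta,\mathbf{r}}=\mathbb{R}^2-\bigcup_{s\in S^1}\left(\mathbf{r}(s)+R_\theta\left(d\mathbf{r}_s(T_s(S^1))\right)\right).$$ The set $\mathcal{NS}_{\mathbf{r}}=\mathcal{NS}_{0,\mathbf{r}}$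 (the complement of the union of all tangent lines) is called the no-silhouette of $\mathbf{r}$; ''$\mathbf{r}$ has its no-silhouette'' means that it is non-empty. In that case the aperture angle $\theta_{\mathbf{r}}$ ($0<\theta_{\mathbf{r}}\le\frac{\pi}{2}$) is the largest angle such that $\mathcal{NS}_{\theta,\mathbf{r}}\neq\emptyset$ for every $\theta$ with $0\le\theta<\theta_{\mathbf{r}}$. The bar denotes topological closure in $\mathbb{R}^2$. For each $\theta\in[0,\theta_{\mathbf{r}})$ the closure $\overline{\mathcal{NS}_{\theta,\mathbf{r}}}$ is a non-empty compact set. $d_H$ is the Pompeiu-Hausdorff metric on the set $\mathcal{H}(\mathbb{R}^2)$ of non-empty compact subsets of $\mathbb{R}^2$: $d_H(A,B)=\max\{d(A,B),d(B,A)\}$, where $d(A,B)=\max_{x\in A}\min_{y\in B}\|x-y\|$. *)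

(* Defs.v *)
(* Mathematical Components with MathComp-Analysis. *)
From mathcomp Require Import all_boot all_order all_algebra.
From mathcomp Require Import ring.
From mathcomp Require Import all_classical all_reals all_analysis.

Set Implicit Arguments.
Unset Strict Implicit.
Unset Printing Implicit Defensive.

Import Order.TTheory GRing.Theory Num.Theory.
Import numFieldNormedType.Exports.

Local Open Scope classical_set_scope.
Local Open Scope ring_scope.

(* The topology of R * R is the usual one of the plane, but its library norm
   `|v| is the maximum norm, hence the following definitions. *)
Definition dotp (R : realType) (v w : R * R) : R := v.1 * w.1 + v.2 * w.2.

Definition enorm (R : realType) (v : R * R) : R := Num.sqrt (dotp v v).

Definition rot (R : realType) (theta : R) (v : R * R) : R * R :=
  (v.1 * cos theta - v.2 * sin theta, v.1 * sin theta + v.2 * cos theta).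

Definition circle (R : realType) := {z : R * R | dotp z z == 1}.

Lemma rot_circle_subproof (R : realType) (u : R) (s : circle R) :
  dotp (rot u (val s)) (rot u (val s)) == 1.
Proof.
apply/eqP; transitivity (dotp (val s) (val s)); last exact/eqP/(valP s).
rewrite /dotp /rot /=.
transitivity (((val s).1 ^+ 2 + (val s).2 ^+ 2) * (cos u ^+ 2 + sin u ^+ 2)).
  by ring.
by rewrite cos2Dsin2; ring.
Qed.

(* For fixed s, u |-> rot_circle u s is a local diffeomorphism from the line
   onto the circle sending 0 to s with unit speed; its restrictions to short
   intervals are charts of the standard smooth structure of the circle. *)
Definition rot_circle (R : realType) (u : R) (s : circle R) : circle R :=
  exist _ (rot u (val s)) (rot_circle_subproof u s).

Definition smooth_circle (R : realType) (r : circle R -> R * R) : Prop :=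
  forall (s : circle R) (n : nat) (u : R),
    derivable (derive1n n (fun t : R => r (rot_circle t s))) u 1.

Definition circle_tangent (R : realType) (s : circle R) : set (R * R) :=
  [set v | dotp (val s) v = 0].

(* The value at s of the unit tangent field of the circle, that is, the
   velocity at u = 0 of u |-> rot_circle u s. *)
Definition unit_tangent (R : realType) (s : circle R) : R * R :=
  (- (val s).2, (val s).1).

(* The differential of r at s, for v in circle_tangent s: such a v is
   dotp v (unit_tangent s) times unit_tangent s. *)
Definition circle_diff (R : realType) (r : circle R -> R * R) (s : circle R)
    (v : R * R) : R * R :=
  dotp v (unit_tangent s) *: derive1 (fun t : R => r (rot_circle t s)) 0.

Definition immersion (R : realType) (r : circle R -> R * R) : Prop :=
  smooth_circle r /\
  forall s : circle R, set_inj (circle_tangent s) (circle_diff r s).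

Definition no_silhouette (R : realType) (theta : R) (r : circle R -> R * R) :
    set (R * R) :=
  ~` \bigcup_(s in [set: circle R])
       [set r s + rot theta w | w in circle_diff r s @` circle_tangent s].

Definition aperture_candidates (R : realType) (r : circle R -> R * R) :
    set R :=
  [set theta | 0 < theta <= pi / 2 /\
     forall t : R, 0 <= t < theta -> no_silhouette t r !=set0].

Definition aperture_angle (R : realType) (r : circle R -> R * R) : R :=
  sup (aperture_candidates r).

(* The supremum is a maximum. *)
Lemma aperture_angle_largest (R : realType) (r : circle R -> R * R) :
  aperture_candidates r !=set0 ->
  aperture_candidates r (aperture_angle r) /\
  ubound (aperture_candidates r) (aperture_angle r).
Proof.
move=> ne.
have hs : has_sup (aperture_candidates r).
  by split=> //; exists (pi / 2) => x [/andP[]].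
have ub := ub_le_sup hs.2.
split; last by move=> x /ub.
have [x xA] := ne; split.
  apply/andP; split; last by apply: ge_sup ne _ => y [/andP[]].
  by case: (xA) => /andP[x0 _] _; exact: lt_le_trans x0 (ub _ xA).
move=> t /andP[t0 /(sup_gt hs.1) [y [_ yP] ty]].
by apply: yP; rewrite t0.
Qed.

(* The excess d(A, B) and the Pompeiu-Hausdorff distance are taken in \bar R,
   with suprema and infima in place of maxima and minima: on non-empty compact
   sets these are attained and finite, while an unbounded or empty set never
   receives a spurious finite value. *)
Definition excess (R : realType) (A B : set (R * R)) : \bar R :=
  ereal_sup [set ereal_inf [set (enorm (x - y))%:E | y in B] | x in A].

Definition hausdorff_dist (R : realType) (A B : set (R * R)) : \bar R :=
  maxe (excess A B) (excess B A).

(* Main.v *)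
From mathcomp Require Import all_boot all_order all_algebra.
From mathcomp Require Import ring lra.
From mathcomp Require Import all_classical all_reals all_analysis.
Require Import Defs.

(** Write c for the closed curve and cross theta v w for the determinant of
R_theta v and w. A point P avoids the line through c(t) with direction
R_theta c'(t) exactly when the sight function
cross theta (c'(t)) (P - c(t)) does not vanish at t. By the intermediate value
theorem the no-silhouette is the set of the P whose sight function has a strict
constant sign; let the weak view be the set of the P for which it has a
constant sign in the wide sense.

The heart of the proof is that, once the no-silhouette at an angle theta with
sin theta <> 0 is empty, the weak view has at most one point
([weak_view_unique]). The sight function is affine in P. If P and Q lie in the
weak view with the same sign, their midpoint has a sight function of the same
sign, which vanishes at some t because the no-silhouette is empty; there the
sight functions of P and Q vanish together, and since they keep their sign,
t is critical for both. Vanishing puts P and Q on the tilted line at c(t), and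
the derivative of the sight function in t is
cross theta (c''(t)) (P - c(t)) + sin theta |c'(t)|^2, so that criticality
determines the position on that line: P = Q. If P and Q have opposite signs,
then cross theta (c') (P - Q) has constant sign, which a closed regular curve
forbids unless P = Q ([loop_turns_back]).

The aperture angle is such an angle ([no_silhouette_aperture]): emptiness at
pi / 2 holds since the distance to P is critical somewhere on the curve, and for
smaller values since a nonempty no-silhouette stays nonempty under small
changes of the angle, by compactness of the circle. Weak views at angles near
the aperture angle are uniformly bounded ([weak_view_bounded]), and a compact
set disjoint from a weak view is disjoint from all the nearby ones
([weak_view_miss]). Hence the limiting weak view is not empty, so it is a single
point P, and the weak views at nearby angles, a fortiori the no-silhouettes, lie
in any prescribed ball around P ([weak_view_shrinks]). *)

Set Implicit Arguments.
Unset Strict Implicit.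
Unset Printing Implicit Defensive.

Import Order.TTheory GRing.Theory Num.Theory.
Import numFieldNormedType.Exports.

Local Open Scope classical_set_scope.
Local Open Scope ring_scope.

(** * The tilted determinant *)

(** At theta = 0 this is the determinant, at theta = pi / 2 the opposite of the
scalar product; keeping theta as a parameter treats both at once. *)
Definition cross (R : realType) (theta : R) (v w : R * R) : R :=
  (rot theta v).1 * w.2 - (rot theta v).2 * w.1.

Definition sight (R : realType) (c : R -> R * R) (theta : R) (P : R * R)
    (t : R) : R :=
  cross theta (derive1 c t) (P - c t).

(** A twice differentiable curve with nonzero velocity that closes up after one
turn; closedness is recorded on the fundamental interval from -pi to pi, the form
in which Rolle's theorem uses it. *)
Definition regular_loop (R : realType) (c : R -> R * R) : Prop :=
  [/\ forall t, derivable c t 1, forall t, derivable (derive1 c) t 1,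
      forall t, derive1 c t != 0 & c (- pi) = c pi].

Lemma rot_add_halfpi (R : realType) (theta : R) (v : R * R) :
  rot (theta + pi / 2) v = (- (rot theta v).2, (rot theta v).1).
Proof.
rewrite /rot cosDpihalf sinDpihalf /=.
congr pair; ring.
Qed.

Lemma rotZ (R : realType) (theta a : R) (v : R * R) :
  rot theta (a *: v) = a *: rot theta v.
Proof.
by rewrite [RHS]surjective_pairing; congr pair; rewrite /= /GRing.scale /=; ring.
Qed.

Lemma cross_halfpi (R : realType) (v w : R * R) :
  cross (pi / 2) v w = - dotp v w.
Proof. by rewrite /cross /rot /dotp cos_pihalf sin_pihalf /=; ring. Qed.

Lemma crossvv (R : realType) (theta : R) (v : R * R) :
  cross theta v v = - (sin theta * dotp v v).
Proof. by rewrite /cross /rot /dotp /=; ring. Qed.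

Lemma crossBr (R : realType) (theta : R) (u v w : R * R) :
  cross theta u (v - w) = cross theta u v - cross theta u w.
Proof. by rewrite /cross /=; ring. Qed.

Lemma crossNr (R : realType) (theta : R) (u v : R * R) :
  cross theta u (- v) = - cross theta u v.
Proof. by rewrite /cross /=; ring. Qed.

Lemma crossZr (R : realType) (theta a : R) (u v : R * R) :
  cross theta u (a *: v) = a * cross theta u v.
Proof. by rewrite /cross /= /GRing.scale /=; ring. Qed.

Lemma dotp_eq0 (R : realType) (v : R * R) : (dotp v v == 0) = (v == 0).
Proof.
case: v => a b; rewrite /dotp /= -!expr2 paddr_eq0 ?sqr_ge0// !sqrf_eq0.
by rewrite xpair_eqE.
Qed.

Lemma dotp_gt0 (R : realType) (v : R * R) : v != 0 -> 0 < dotp v v.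
Proof.
move=> v0; rewrite lt_neqAle eq_sym dotp_eq0 v0 /=.
by rewrite /dotp -!expr2 addr_ge0 ?sqr_ge0.
Qed.

Lemma dotp_rot (R : realType) (theta : R) (v : R * R) :
  dotp (rot theta v) (rot theta v) = dotp v v.
Proof.
transitivity (dotp v v * (cos theta ^+ 2 + sin theta ^+ 2)).
  by rewrite /dotp /rot /=; ring.
by rewrite cos2Dsin2 mulr1.
Qed.

Lemma cross_eq0 (R : realType) (theta : R) (v w : R * R) :
  v != 0 -> cross theta v w = 0 <-> exists a, w = a *: rot theta v.
Proof.
move=> v0; split=> [|[a ->]].
  have := dotp_gt0 v0; rewrite -(dotp_rot theta) /cross.
  case: (rot theta v) => a b; case: w => x y; rewrite /dotp /= => d0 e.
  exists ((a * x + b * y) / (a * a + b * b)).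
  have -> : (x, y) = ((a * x + b * y) / (a * a + b * b) * a,
                      (a * x + b * y) / (a * a + b * b) * b).
    congr pair; apply/(mulIf (lt0r_neq0 d0));
      rewrite mulrAC divfK ?lt0r_neq0//.
      by transitivity (x * (a * a + b * b) + b * (a * y - b * x));
        [rewrite e mulr0 addr0 | ring].
    by transitivity (y * (a * a + b * b) - a * (a * y - b * x));
      [rewrite e mulr0 subr0 | ring].
  by [].
by rewrite crossZr /cross [_.2 * _]mulrC subrr mulr0.
Qed.

(** The two values are, up to sign, the scalar products of w with R_theta v and its
quarter turn, orthogonal vectors of length |v|, so their squares add up to
|v|^2 |w|^2. *)
Lemma cross_perp_eq0 (R : realType) (theta : R) (v w : R * R) :
  cross theta v w = 0 -> cross (theta + pi / 2) v w = 0 -> v = 0 \/ w = 0.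
Proof.
move=> e1 e2.
suff : dotp v v * dotp w w = 0.
  by move/eqP; rewrite mulf_eq0 !dotp_eq0 => /orP[]/eqP; [left|right].
transitivity (cross theta v w ^+ 2 + cross (theta + pi / 2) v w ^+ 2).
  by rewrite -(dotp_rot theta v) /cross rot_add_halfpi /dotp /=; ring.
by rewrite e1 e2 expr0n addr0.
Qed.

(** * Differentiating along the curve *)

Lemma is_derive_coord (R : realType) (c : R -> R * R) (t : R) :
  derivable c t 1 ->
  is_derive t 1 (fun u => (c u).1) (derive1 c t).1 /\
  is_derive t 1 (fun u => (c u).2) (derive1 c t).2.
Proof.
move=> dc; have cc : h^-1 *: (c (h + t) - c t) @[h --> 0^'] --> derive1 c t.
  have : h^-1 *: (c (h *: 1 + t) - c t) @[h --> 0^'] --> 'D_1 c t by exact: dc.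
  by rewrite derive1E; under eq_fun do rewrite [_ *: 1]mulr1.
have aux (f : R * R -> R) : continuous f ->
    (forall a v, f (a *: v) = a * f v) -> (forall v w, f (v - w) = f v - f w) ->
    is_derive t 1 (fun u => f (c u)) (f (derive1 c t)).
  move=> fc fZ fB.
  have l : h^-1 *: (f (c (h *: 1 + t)) - f (c t)) @[h --> 0^'] --> f (derive1 c t).
    have -> : (fun h => h^-1 *: (f (c (h *: 1 + t)) - f (c t))) =
        f \o (fun h => h^-1 *: (c (h + t) - c t)).
      by apply/funext => h /=; rewrite fZ fB [h *: 1]mulr1.
    by apply: continuous_cvg => //; exact: fc.
  by apply: DeriveDef; [apply/cvg_ex; exists (f (derive1 c t)) | exact: cvg_lim].
split; apply: aux => //; try (by move=> ? ?).
- by move=> v; exact: cvg_fst.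
- by move=> v; exact: cvg_snd.
Qed.

Lemma is_derive_cross (R : realType) (theta : R) (f g : R -> R * R) (t : R) :
  derivable f t 1 -> derivable g t 1 ->
  is_derive t 1 (fun u => cross theta (f u) (g u))
    (cross theta (derive1 f t) (g t) + cross theta (f t) (derive1 g t)).
Proof.
move=> /is_derive_coord[f1 f2] /is_derive_coord[g1 g2].
rewrite /cross /rot /=; apply: is_derive_eq.
move: (f t) (g t) (derive1 f t) (derive1 g t) => [? ?] [? ?] [? ?] [? ?].
by rewrite /GRing.scale /=; ring.
Qed.

Lemma is_derive_crossl (R : realType) (theta : R) (f : R -> R * R)
    (v : R * R) (t : R) :
  derivable f t 1 ->
  is_derive t 1 (fun u => cross theta (f u) v) (cross theta (derive1 f t) v).
Proof.
move=> df; have := is_derive_cross theta df (derivable_cst v t 1).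
by rewrite derive1_cst /cross /= !mulr0 subrr addr0.
Qed.

Lemma derive1_subl (R : realType) (c : R -> R * R) (P : R * R) (t : R) :
  derivable c t 1 ->
  derivable (fun u => P - c u) t 1 /\
  derive1 (fun u => P - c u) t = - derive1 c t.
Proof.
move=> /derivableP dc; have d := is_deriveB (is_derive_cst P t 1) dc.
split; first by exact: (@ex_derive _ _ _ _ _ _ _ d).
by rewrite !derive1E (@derive_val _ _ _ _ _ _ _ d) sub0r.
Qed.

(** The second term comes from moving the foot of the line: it is
- cross theta c' c', and it is what makes positive angles rigid. *)
Lemma is_derive_sight (R : realType) (c : R -> R * R) (theta : R)
    (P : R * R) (t : R) :
  derivable c t 1 -> derivable (derive1 c) t 1 ->
  is_derive t 1 (sight c theta P)
    (cross theta (derive1 (derive1 c) t) (P - c t)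
     + sin theta * dotp (derive1 c t) (derive1 c t)).
Proof.
move=> dc ddc.
have [dP eP] := derive1_subl P dc.
apply: is_derive_eq (is_derive_cross theta ddc dP) _.
by congr (_ + _); rewrite eP crossNr crossvv opprK.
Qed.

Lemma loop_rolle (R : realType) (f : R -> R) :
  (forall t, derivable f t 1) -> f (- pi) = f pi ->
  exists2 t, - pi < t < pi & is_derive t 1 f 0.
Proof.
move=> df fpi; have pi0 := pi_gt0 R.
have [||t tI dt] := Rolle _ (fun x _ => df x) _ fpi.
- by rewrite gtrN.
- by apply: derivable_within_continuous => x _.
by exists t.
Qed.

(** * Geometry of a closed curve *)

(** Otherwise the component of c in a fixed direction would be nondecreasing over
one turn, hence constant, with zero derivative; where the other component is
critical, the velocity would then vanish. *)
Lemma loop_turns_back (R : realType) (c : R -> R * R) (theta : R) (v : R * R) :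
  regular_loop c -> v != 0 -> exists t, cross theta (derive1 c t) v < 0.
Proof.
move=> [dc _ c'0 cpi] v0; have pi0 := pi_gt0 R.
apply: contrapT => /forallNP ge0.
have {}ge0 t : 0 <= cross theta (derive1 c t) v.
  by rewrite leNgt; apply/negP/ge0.
pose h (th : R) t := cross th (c t) v.
have dh (th t : R) : is_derive t 1 (h th) (cross th (derive1 c t) v).
  exact: is_derive_crossl.
have dh' (th t : R) : derivable (h th) t 1 by exact: (@ex_derive _ _ _ _ _ _ _ (dh th t)).
(* t is a critical point of the component along the other axis. *)
have [|t /andP[tl tr] ht] := loop_rolle (dh' (theta + pi / 2)).
  by rewrite /h cpi.
have hmono : {homo h theta : x y / x <= y}.
  move=> x y xy.
  have := @ger0_derive1_ndecr _ (h theta) x y _ _ _ x y.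
  apply => // [u _|]; first by rewrite derive1E (@derive_val _ _ _ _ _ _ _ (dh theta u)).
  exact: derivable_within_continuous.
(* Being monotone with equal end values, h theta is constant on one turn, so t
   is a maximum of it. *)
have h0 : is_derive t 1 (h theta) 0.
  apply: (@derive1_at_max _ _ (- pi) pi) => //.
  - by rewrite -subr_ge0 opprK addr_ge0// ltW.
  - by rewrite in_itv /= tl.
  move=> u; rewrite in_itv /= => /andP[ul ur].
  apply: le_trans (hmono _ _ (ltW ur)) _.
  by rewrite /h -cpi; exact/hmono/ltW.
have e1 : cross theta (derive1 c t) v = 0.
  by rewrite -(@derive_val _ _ _ _ _ _ _ (dh theta t)) (@derive_val _ _ _ _ _ _ _ h0).
have e2 : cross (theta + pi / 2) (derive1 c t) v = 0.
  by rewrite -(@derive_val _ _ _ _ _ _ _ (dh _ t)) (@derive_val _ _ _ _ _ _ _ ht).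
by case: (cross_perp_eq0 e1 e2) => e; [have := c'0 t | move: v0]; rewrite e eqxx.
Qed.

(** At angle pi / 2 the lines are the normals: they meet P where the distance from
P to the curve is critical. *)
Lemma sight_halfpi_vanishes (R : realType) (c : R -> R * R) (P : R * R) :
  regular_loop c -> exists t, sight c (pi / 2) P t = 0.
Proof.
move=> [dc ddc _ cpi].
have dP (t : R) : derivable (fun u => P - c u) t 1 by have [] := derive1_subl P (dc t).
have dD t := is_derive_cross (pi / 2) (dP t) (dP t).
have dD' t := @ex_derive _ _ _ _ _ _ _ (dD t).
have [|t _ ht] := loop_rolle dD'; first by rewrite cpi.
exists t.
have := @derive_val _ _ _ _ _ _ _ (dD t); rewrite (@derive_val _ _ _ _ _ _ _ ht).
rewrite (derive1_subl P (dc t)).2 /sight !cross_halfpi /dotp /= => e; lra.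
Qed.

Lemma sight_affine (R : realType) (c : R -> R * R) (theta a : R) (P Q : R * R) t :
  sight c theta (a *: P + (1 - a) *: Q) t
  = a * sight c theta P t + (1 - a) * sight c theta Q t.
Proof.
rewrite /sight /cross /= /GRing.scale /=; ring.
Qed.

(** Vanishing forces P - c(t) = a R_theta c'(t), and vanishing of the derivative
then reads a cross theta c'' (R_theta c') = - sin theta |c'|^2. The right-hand
side is not zero, so this equation determines a. *)
Lemma sight_zero_unique (R : realType) (c : R -> R * R) (theta : R) (P Q : R * R) t :
  regular_loop c -> sin theta != 0 ->
  sight c theta P t = 0 -> sight c theta Q t = 0 ->
  is_derive t 1 (sight c theta P) 0 -> is_derive t 1 (sight c theta Q) 0 ->
  P = Q.
Proof.
move=> [dc ddc c'0 _] s0 P0 Q0 dP dQ.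
have crit X : is_derive t 1 (sight c theta X) 0 ->
    cross theta (derive1 (derive1 c) t) (X - c t)
    = - (sin theta * dotp (derive1 c t) (derive1 c t)).
  move=> dX; apply/eqP; rewrite -subr_eq0 opprK; apply/eqP.
  rewrite -(@derive_val _ _ _ _ _ _ _ dX).
  by rewrite (@derive_val _ _ _ _ _ _ _ (is_derive_sight theta X (dc t) (ddc t))).
have {P0} [a eP] := (cross_eq0 theta _ (c'0 t)).1 P0.
have {Q0} [b eQ] := (cross_eq0 theta _ (c'0 t)).1 Q0.
have := crit _ dQ; have := crit _ dP; rewrite eP eQ !crossZr => <- /eqP.
rewrite -subr_eq0 -mulrBl mulf_eq0 => /orP[|/eqP z].
  rewrite subr_eq0 => /eqP ba.
  by apply/(addIr (- c t)); rewrite eP eQ ba.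
have := crit _ dP; rewrite eP crossZr z mulr0 => /esym/eqP.
by rewrite oppr_eq0 mulf_eq0 (negbTE s0) gt_eqF// dotp_gt0.
Qed.

(** * Clear and weak views *)

Definition clear_view (R : realType) (c : R -> R * R) (theta : R) : set (R * R) :=
  [set P | forall t, sight c theta P t != 0].

(** The sign is left free, so that no choice of orientation of the curve is needed:
the points of both signs together still form at most one point at the limit
angle. *)
Definition weak_view (R : realType) (c : R -> R * R) (theta : R) : set (R * R) :=
  [set P | (forall t, 0 <= sight c theta P t) \/
           (forall t, sight c theta P t <= 0)].

Lemma derivable_sight (R : realType) (c : R -> R * R) (theta : R)
    (P : R * R) (t : R) :
  regular_loop c -> derivable (sight c theta P) t 1.
Proof.
move=> [dc ddc _ _].
exact: (@ex_derive _ _ _ _ _ _ _ (is_derive_sight theta P (dc t) (ddc t))).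
Qed.

Lemma clear_view_sub (R : realType) (c : R -> R * R) (theta : R) :
  regular_loop c -> clear_view c theta `<=` weak_view c theta.
Proof.
move=> rc P Pn0; apply: contrapT => /not_orP[/existsNP[a /negP]].
rewrite -ltNge => fa /existsNP[b /negP]; rewrite -ltNge => fb.
have cont x y : {within `[x, y], continuous (sight c theta P)}.
  by apply: derivable_within_continuous => u _; exact: derivable_sight.
have [u _] : exists2 u, u \in `[Num.min a b, Num.max a b] &
    sight c theta P u = 0.
  apply: IVT => //; first by rewrite ge_min !le_max !lexx.
  by case: (leP a b) => _; rewrite ge_min le_max ?(ltW fa) ?(ltW fb) ?orbT.
by move/eqP; rewrite (negbTE (Pn0 u)).
Qed.

(** Two points of opposite signs are separated by [loop_turns_back]; for two points
of the same sign, a zero of the sight function of their midpoint is a common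
extremal zero, and [sight_zero_unique] applies. *)
Lemma weak_view_unique (R : realType) (c : R -> R * R) (theta : R)
    (P Q : R * R) :
  regular_loop c -> sin theta != 0 -> clear_view c theta = set0 ->
  weak_view c theta P -> weak_view c theta Q -> P = Q.
Proof.
move=> rc s0 empty.
have opposite X Y : (forall t, 0 <= sight c theta X t) ->
    (forall t, sight c theta Y t <= 0) -> X = Y.
  move=> X0 Y0; apply/eqP; rewrite -subr_eq0; apply: contraT => XY.
  have [t] := loop_turns_back theta rc XY.
  have -> : X - Y = (X - c t) - (Y - c t) by rewrite opprB addrA subrK.
  by rewrite crossBr ltNge subr_ge0 (le_trans (Y0 t) (X0 t)).
have critical X t : weak_view c theta X -> sight c theta X t = 0 ->
    is_derive t 1 (sight c theta X) 0.
  move=> Xw Xt.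
  have tI : t \in `]t - 1, t + 1[ by rewrite in_itv /=; lra.
  have le1 : t - 1 <= t + 1 by lra.
  have dX u : u \in `]t - 1, t + 1[ -> derivable (sight c theta X) u 1.
    by move=> _; exact: derivable_sight.
  by case: Xw => X0; [apply: (derive1_at_min le1)|apply: (derive1_at_max le1)];
    rewrite // ?Xt.
have common X Y t : weak_view c theta X -> weak_view c theta Y ->
    sight c theta X t = 0 -> sight c theta Y t = 0 -> X = Y.
  move=> Xw Yw X0 Y0.
  exact: (sight_zero_unique rc s0 X0 Y0 (critical _ _ Xw X0) (critical _ _ Yw Y0)).
have [t] : exists t, sight c theta (2^-1 *: P + (1 - 2^-1) *: Q) t = 0.
  apply: contrapT => /forallNP M0.
  suff : clear_view c theta (2^-1 *: P + (1 - 2^-1) *: Q) by rewrite empty.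
  by move=> t; apply/eqP/M0.
rewrite sight_affine => Mt Pw Qw.
case: (Pw) (Qw) => [P0|P0] [Q0|Q0].
- by apply: (common _ _ t) => //; have := P0 t; have := Q0 t; lra.
- exact: opposite.
- exact/esym/opposite.
- by apply: (common _ _ t) => //; have := P0 t; have := Q0 t; lra.
Qed.

(** * Compactness *)

Lemma cvg_cross (R : realType) (T : Type) (F : set_system T) (FF : Filter F)
    (f : T -> R) (v w : T -> R * R) (theta : R) (a b : R * R) :
  f x @[x --> F] --> theta -> v x @[x --> F] --> a -> w x @[x --> F] --> b ->
  cross (f x) (v x) (w x) @[x --> F] --> cross theta a b.
Proof.
move=> fl vl wl.
have fcos := continuous_cvg FF (@continuous_cos R theta) fl.
have fsin := continuous_cvg FF (@continuous_sin R theta) fl.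
have cvg1 (u : T -> R * R) (l : R * R) :
    u x @[x --> F] --> l -> (u x).1 @[x --> F] --> l.1.
  by move=> ul; apply: (cvg_comp _ _ ul); exact: cvg_fst.
have cvg2 (u : T -> R * R) (l : R * R) :
    u x @[x --> F] --> l -> (u x).2 @[x --> F] --> l.2.
  by move=> ul; apply: (cvg_comp _ _ ul); exact: cvg_snd.
have [v1 v2] := (cvg1 _ _ vl, cvg2 _ _ vl); have [w1 w2] := (cvg1 _ _ wl, cvg2 _ _ wl).
rewrite /cross /rot /=.
by apply: cvgB; apply: cvgM => //; [apply: cvgB|apply: cvgD]; apply: cvgM.
Qed.

Lemma derivable_cvg (R : realType) (f : R -> R * R) (t : R) :
  derivable f t 1 -> f x @[x --> t] --> f t.
Proof. by move=> /derivable1_diffP /differentiable_continuous. Qed.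

Lemma clear_near (R : realType) (c : R -> R * R) (theta : R) (P : R * R) (a b : R) :
  regular_loop c -> (forall t, t \in `[a, b] -> sight c theta P t != 0) ->
  \forall x \near theta, forall t, t \in `[a, b] -> sight c x P t != 0.
Proof.
move=> [dc ddc _ _] P0.
have /compact_near_coveringP cov := @segment_compact R a b.
apply: (cov R (nbhs theta) (fun x t => sight c x P t != 0) _) => t tI.
have l : sight c x.2 P x.1 @[x --> (t, theta)] --> sight c theta P t.
  apply: cvg_cross.
  - exact: cvg_snd.
  - by apply: cvg_comp (derivable_cvg (ddc t)); exact: cvg_fst.
  - apply: cvgB; first exact: cvg_cst.
    by apply: cvg_comp (derivable_cvg (dc t)); exact: cvg_fst.
have := P0 t tI; rewrite neq_lt => /orP[lt0|gt0].
- by near=> x; rewrite lt_eqF//; near: x; exact: (cvgr_lt _ l).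
- by near=> x; rewrite gt_eqF//; near: x; exact: (cvgr_gt _ l).
Unshelve. all: by end_near.
Qed.

(** A point is outside a weak view when its sight function takes both signs, which
is an open condition on the point and the angle together. *)
Lemma weak_view_miss (R : realType) (c : R -> R * R) (theta : R)
    (D : set (R * R)) :
  compact D -> D `&` weak_view c theta = set0 ->
  \forall x \near theta, D `&` weak_view c x = set0.
Proof.
move=> /compact_near_coveringP cov miss.
have H : \forall x \near theta, D `<=` [set P | (exists t, sight c x P t < 0) /\
     (exists t, 0 < sight c x P t)].
  apply: (cov R (nbhs theta) (fun x P => (exists t, sight c x P t < 0) /\
     (exists t, 0 < sight c x P t)) _) => P DP.
  have lim t : sight c x.2 x.1 t @[x --> (P, theta)] --> sight c theta P t.
    apply: cvg_cross; [exact: cvg_snd|exact: cvg_cst|].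
    by apply: cvgB; [exact: cvg_fst|exact: cvg_cst].
  have /not_orP[] : ~ weak_view c theta P.
    by move=> PW; have : (D `&` weak_view c theta) P by []; rewrite miss.
  move=> /existsNP[t /negP]; rewrite -ltNge => lt0.
  move=> /existsNP[u /negP]; rewrite -ltNge => gt0.
  near=> x; split.
    by exists t; near: x; exact: (cvgr_lt _ (lim t)).
  by exists u; near: x; exact: (cvgr_gt _ (lim u)).
apply: filterS H => x H; apply/seteqP; split=> // P [/H[[t tlt] [u ugt]]].
by case=> [/(_ t)|/(_ u)]; rewrite leNgt ?tlt ?ugt.
Unshelve. all: by end_near.
Qed.

Lemma compact_box (R : realType) (M : R) : compact [set v : R * R | `|v| <= M].
Proof.
have -> : [set v : R * R | `|v| <= M] = `[- M, M] `*` `[- M, M].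
  apply/seteqP; split=> -[a b] /=;
    by rewrite !in_itv /= prod_normE /= ge_max !ler_norml => /andP.
by apply: compact_setX; exact: segment_compact.
Qed.

Lemma compact_box_ge (R : realType) (M e : R) (P : R * R) :
  compact [set v : R * R | `|v| <= M /\ e <= `|v - P|].
Proof.
apply: (subclosed_compact _ (compact_box (M := M))); last by move=> v [].
apply: closedI.
  apply: (closed_comp _ (@closed_le _ M)) => v _; exact: norm_continuous.
apply: (closed_comp (f := fun v : R * R => `|v - P|) _ (@closed_ge _ e)) => v _.
by apply: cvg_norm; apply: cvgB; [exact: cvg_id|exact: cvg_cst].
Qed.

(** Homogenise: for k = 1 / |P| and v = k P, the sight function of P is |P| times
cross theta c' (v - k c). As k tends to 0 this expression tends to
cross theta c' v, which takes both signs by [loop_turns_back]; by compactness of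
the unit sphere it still takes both signs for all small k, whatever v is, and
for all nearby angles. So points of the weak view are not far away. *)
Lemma weak_view_bounded (R : realType) (c : R -> R * R) (theta : R) :
  regular_loop c ->
  exists M, \forall x \near theta, forall P, weak_view c x P -> `|P| <= M.
Proof.
move=> rc.
pose S := [set v : R * R | `|v| <= 1 /\ 1 <= `|v - 0|].
have /compact_near_coveringP cov : compact S by exact: compact_box_ge.
pose G (i : R * R) v t := cross i.1 (derive1 c t) (v - i.2 *: c t).
have [[A B] /= [At B0] AB] : \forall i \near (theta, 0 : R), S `<=`
    [set v | (exists t, G i v t < 0) /\ (exists t, 0 < G i v t)].
  apply: (cov _ (nbhs (theta, 0 : R)) (fun i v =>
    (exists t, G i v t < 0) /\ (exists t, 0 < G i v t)) _).
  move=> v [_ v1].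
  have v0 : v != 0 by rewrite -normr_gt0 -(subr0 v) (lt_le_trans _ v1).
  have lim t : G x.2 x.1 t @[x --> (v, (theta, 0))] --> cross theta (derive1 c t) v.
    rewrite -[in X in _ --> X](subr0 v) -[in X in _ --> X](scale0r (c t)).
    apply: cvg_cross; [|exact: cvg_cst|apply: cvgB; first exact: cvg_fst].
      apply: (cvg_comp snd fst); [exact: cvg_snd|exact: cvg_fst].
    apply: cvgZr_tmp.
    apply: (cvg_comp snd snd); [exact: cvg_snd|exact: cvg_snd].
  have [t tlt] := loop_turns_back theta rc v0.
  have nv0 : - v != 0 by rewrite oppr_eq0.
  have [u] := loop_turns_back theta rc nv0.
  rewrite crossNr oppr_lt0 => ugt.
  near=> x; split.
    by exists t; near: x; exact: (cvgr_lt _ (lim t)).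
  by exists u; near: x; exact: (cvgr_gt _ (lim u)).
have /nbhs_ballP[d /= d0 dB] := B0.
exists d^-1; apply: filterS At => x Ax P Pw; rewrite leNgt; apply/negP => Plt.
have P0 : 0 < `|P| by apply: lt_trans Plt; rewrite invr_gt0.
have Bl : B `|P|^-1.
  apply: dB; rewrite /ball /= sub0r normrN gtr0_norm ?invr_gt0//.
  by rewrite -[ltRHS]invrK ltf_pV2 ?posrE ?invr_gt0.
have nv : `| `|P|^-1 *: P| = 1.
  by rewrite normrZ gtr0_norm ?invr_gt0// mulVf// gt_eqF.
have [] := AB (x, `|P|^-1) (conj Ax Bl) (`|P|^-1 *: P).
  by rewrite /S /= subr0 nv.
have GE t : G (x, `|P|^-1) (`|P|^-1 *: P) t = `|P|^-1 * sight c x P t.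
  by rewrite /G -scalerBr crossZr.
move=> -[t] + [u]; rewrite !GE.
rewrite pmulr_rlt0 ?invr_gt0// pmulr_rgt0 ?invr_gt0// => tlt ugt.
by case: Pw => [/(_ t)|/(_ u)]; rewrite leNgt ?tlt ?ugt.
Unshelve. all: by end_near.
Qed.

(** Existence of the limit point: if the weak view at theta were empty, a box that
contains all nearby weak views would be disjoint from it, hence disjoint from the
nearby ones, making them empty too. Convergence: the same argument applies to
the box minus an open ball around the point. *)
Lemma weak_view_shrinks (R : realType) (c : R -> R * R) (theta : R) :
  regular_loop c -> sin theta != 0 -> clear_view c theta = set0 ->
  (forall A, nbhs theta A -> exists2 x, A x & weak_view c x !=set0) ->
  exists P, forall e, 0 < e ->
    \forall x \near theta, forall Q, weak_view c x Q -> `|Q - P| < e.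
Proof.
move=> rc s0 empty adh; have [M bounded] := weak_view_bounded theta rc.
have [P Pw] : weak_view c theta !=set0.
  apply/set0P/eqP => none.
  have miss : [set v : R * R | `|v| <= M] `&` weak_view c theta = set0.
    by rewrite none setI0.
  have miss_near := weak_view_miss (@compact_box R M) miss.
  have [x [bx mx] [Q Qw]] := adh _ (filterI bounded miss_near).
  have : ([set v : R * R | `|v| <= M] `&` weak_view c x) Q by split; [exact: bx|].
  by rewrite mx.
exists P => e e0; have cD := @compact_box_ge R M e P.
have miss : [set v : R * R | `|v| <= M /\ e <= `|v - P|] `&` weak_view c theta = set0.
  apply/seteqP; split=> // Q [[_ eQ] Qw].
  have QP := weak_view_unique rc s0 empty Qw Pw.
  by move: eQ; rewrite QP subrr normr0 leNgt e0.
apply: filterS (filterI bounded (weak_view_miss cD miss)) => x [bx mx] Q Qw.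
rewrite ltNge; apply/negP => eQ.
have : ([set v : R * R | `|v| <= M /\ e <= `|v - P|] `&` weak_view c x) Q.
  by split=> //; split=> //; exact: bx.
by rewrite mx.
Qed.

(** * Hausdorff distance to a point *)

Lemma enorm_le (R : realType) (v : R * R) : enorm v <= `|v.1| + `|v.2|.
Proof.
rewrite -[leRHS]ger0_norm ?addr_ge0// -sqrtr_sqr ler_wsqrtr//.
rewrite /dotp -!expr2 sqrrD !real_normK ?num_real//.
by rewrite lerD2r lerDl mulrn_wge0// mulr_ge0.
Qed.

Lemma norm_le_enorm (R : realType) (v : R * R) : `|v| <= enorm v.
Proof.
rewrite prod_normE ge_max -!sqrtr_sqr /enorm /dotp -!expr2.
by rewrite !ler_wsqrtr// ?lerDl ?lerDr sqr_ge0.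
Qed.

Lemma excess_point (R : realType) (A : set (R * R)) (P : R * R) :
  excess A [set P] = ereal_sup [set (enorm (x - P))%:E | x in A].
Proof.
by rewrite /excess; under eq_imagel do rewrite image_set1 ereal_inf1.
Qed.

(** The bound is doubled because the hypothesis is in the maximum norm of the plane
while the distance is Euclidean. *)
Lemma hausdorff_dist_point_le (R : realType) (A : set (R * R)) (P : R * R)
    (e : R) :
  A !=set0 -> (forall x, A x -> `|x - P| <= e) ->
  (0%:E <= hausdorff_dist (closure A) [set P] <= (e + e)%:E)%E.
Proof.
move=> [x Ax] Ae.
have cAe y : closure A y -> `|y - P| <= e.
  have cl : closed [set y : R * R | `|y - P| <= e].
    apply: (closed_comp (f := fun v : R * R => `|v - P|) _ (@closed_le _ e)) => v _.
    by apply: cvg_norm; apply: cvgB; [exact: cvg_id|exact: cvg_cst].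
  by move=> Ay; apply: (cl y); apply: closureS Ay => z /Ae.
have ene y : `|y - P| <= e -> enorm (y - P) <= e + e.
  rewrite prod_normE ge_max => /andP[y1 y2].
  by apply: le_trans (enorm_le _) (lerD y1 y2).
have ex : (excess (closure A) [set P] <= (e + e)%:E)%E.
  rewrite excess_point; apply: ge_ereal_sup => _ [y Ay <-].
  by rewrite lee_fin ene// cAe.
have Cx : closure A x by exact: subset_closure.
apply/andP; split; rewrite /hausdorff_dist.
  rewrite le_max excess_point; apply/orP; left.
  apply: le_trans (ereal_sup_ubound _); last by exists x.
  by rewrite lee_fin sqrtr_ge0.
rewrite ge_max ex /excess image_set1 ereal_sup1 /=.
apply: le_trans (ereal_inf_lbound _) _; first by exists x.
have -> : enorm (P - x) = enorm (x - P).
  by rewrite /enorm /dotp; congr Num.sqrt; rewrite /=; ring.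
by rewrite lee_fin ene// Ae.
Qed.

Lemma hausdorff_dist_point_lt (R : realType) (A : set (R * R)) (P x : R * R)
    (e : R) :
  A x -> (hausdorff_dist (closure A) [set P] < e%:E)%E -> `|x - P| < e.
Proof.
move=> Ax; rewrite /hausdorff_dist gt_max => /andP[+ _].
rewrite excess_point -lte_fin; apply: le_lt_trans.
apply: le_trans (ereal_sup_ubound _); last by exists x; first exact: subset_closure.
by rewrite lee_fin norm_le_enorm.
Qed.

Lemma ereal_squeeze0 (R : realType) (u : nat -> \bar R) :
  (forall e, 0 < e -> \forall i \near \oo, (0%:E <= u i <= e%:E)%E) ->
  u i @[i --> \oo] --> 0%:E.
Proof.
move=> ue; have fin e i : (0%:E <= u i <= e%:E)%E -> u i \is a fin_num.
  by move=> /andP[u0 u1]; rewrite ge0_fin_numE//; exact: le_lt_trans u1 (ltry _).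
apply/fine_cvgP; split.
  by apply: filterS (ue 1 ltr01) => i /fin.
apply/cvgrPdist_le => e e0; apply: filterS (ue e e0) => i ui.
have fi := fin _ _ ui; move: ui; rewrite -(fineK fi) !lee_fin => /andP[u0 u1].
by rewrite sub0r normrN /= ger0_norm// fineK.
Qed.

(** * Unrolling the circle *)

Lemma circle_base_subproof (R : realType) : dotp (1, 0 : R) (1, 0) == 1.
Proof. by rewrite /dotp /= mulr1 mulr0 addr0. Qed.

Definition circle_base (R : realType) : circle R :=
  exist _ (1, 0) (circle_base_subproof R).

Definition unroll (R : realType) (r : circle R -> R * R) (t : R) : R * R :=
  r (rot_circle t (circle_base R)).

Lemma rot_circleD (R : realType) (u t : R) (s : circle R) :
  rot_circle (u + t) s = rot_circle u (rot_circle t s).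
Proof.
by apply/val_inj; rewrite /= /rot /= cosD sinD; congr pair; ring.
Qed.

Lemma circle_point (R : realType) (s : circle R) :
  exists2 t, t \in `[- pi, pi] & s = rot_circle t (circle_base R).
Proof.
case: s => -[a b] ab1; have := ab1; rewrite /dotp /= -!expr2 => /eqP ab.
have a1 : -1 <= a <= 1.
  by have b2 := sqr_ge0 b; apply/andP; split; nra.
have sb : sin (acos a) = `|b|.
  by rewrite sin_acos// -ab addrC addKr sqrtr_sqr.
have ca : cos (acos a) = a by rewrite acosK// in_itv.
have := acos_ge0 a1; have := acos_lepi a1 => ap a0; have pi0 := pi_gt0 R.
have [b0|b0] := leP 0 b.
- exists (acos a); first by rewrite in_itv /= ap andbT; lra.
  by apply/val_inj; rewrite /= /rot /= ca sb ger0_norm//; congr pair; ring.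
- exists (- acos a); first by rewrite in_itv /=; apply/andP; split; lra.
  apply/val_inj; rewrite /= /rot /= cosN sinN ca sb ltr0_norm//.
  by congr pair; ring.
Qed.

Lemma derive1_unroll (R : realType) (r : circle R -> R * R) (t : R) :
  derive1 (unroll r) t
  = derive1 (fun u => r (rot_circle u (rot_circle t (circle_base R)))) 0.
Proof.
rewrite /derive1 /unroll.
by under [in RHS]eq_fun do rewrite -!rot_circleD add0r addr0.
Qed.

Lemma dotp_unit_tangent (R : realType) (s : circle R) :
  dotp (unit_tangent s) (unit_tangent s) = 1.
Proof. by rewrite -(eqP (valP s)) /dotp /=; ring. Qed.

Lemma immersion_derive_neq0 (R : realType) (r : circle R -> R * R)
    (s : circle R) :
  immersion r -> derive1 (fun t => r (rot_circle t s)) 0 != 0.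
Proof.
move=> [_ inj]; apply/eqP => d0.
have := dotp_unit_tangent s.
have -> : unit_tangent s = 0.
  apply: (inj s); rewrite ?inE /circle_tangent /circle_diff /=.
  - by rewrite /dotp /=; ring.
  - by rewrite /dotp /= !mulr0 addr0.
  - by rewrite d0 !scaler0.
by rewrite /dotp /= !mulr0 addr0 => /esym/eqP; rewrite oner_eq0.
Qed.

(** Since the differential does not vanish, its image is the whole line spanned by
the velocity, and P lies on the tilted line through r s exactly when the tilted
determinant vanishes. *)
Lemma no_silhouetteE (R : realType) (r : circle R -> R * R) (theta : R)
    (P : R * R) :
  immersion r ->
  no_silhouette theta r P <->
  forall s, cross theta (derive1 (fun t => r (rot_circle t s)) 0) (P - r s) != 0.
Proof.
move=> ir; split=> [nsP s|ns [s _ [_ [v _ <-] e]]].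
- apply/eqP => /(cross_eq0 _ _ (immersion_derive_neq0 s ir))[a ea].
  apply: nsP; exists s => //.
  exists (circle_diff r s (a *: unit_tangent s)).
    exists (a *: unit_tangent s) => //.
    by rewrite /circle_tangent /dotp /= /GRing.scale /=; ring.
  rewrite -[P](subrK (r s)) ea addrC; congr (_ + _).
  have -> : circle_diff r s (a *: unit_tangent s) =
            a *: derive1 (fun t => r (rot_circle t s)) 0.
    rewrite /circle_diff; congr (_ *: _).
    rewrite -[RHS]mulr1 -(dotp_unit_tangent s) /dotp /= /GRing.scale /=; ring.
  by rewrite rotZ.
- have := ns s; rewrite -e addrC addKr /circle_diff /cross /rot /=.
  by rewrite /GRing.scale /= => /eqP; apply; ring.
Qed.

Lemma unroll_regular_loop (R : realType) (r : circle R -> R * R) :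
  immersion r -> regular_loop (unroll r).
Proof.
move=> ir; have [smooth _] := ir; split.
- by move=> t; exact: (smooth (circle_base R) 0%N).
- by move=> t; exact: (smooth (circle_base R) 1%N).
- by move=> t; rewrite derive1_unroll immersion_derive_neq0.
- congr r; apply/val_inj; rewrite /= /rot /= cosN sinN sinpi.
  by congr pair; ring.
Qed.

(** Angles from a compact interval already reach the whole circle; this is the form
used for compactness arguments, while [no_silhouette_clear_view] lets t range over
the line, as differentiation requires. *)
Lemma no_silhouette_segment (R : realType) (r : circle R -> R * R)
    (theta : R) (P : R * R) :
  immersion r ->
  no_silhouette theta r P <->
  forall t, t \in `[- pi, pi] -> sight (unroll r) theta P t != 0.
Proof.
move=> ir; apply: iff_trans (no_silhouetteE theta P ir) _; split=> ns.
- by move=> t _; rewrite /sight derive1_unroll; exact: ns.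
- move=> s; have [t tI ->] := circle_point s.
  by rewrite -derive1_unroll; exact: ns.
Qed.

Lemma no_silhouette_clear_view (R : realType) (r : circle R -> R * R)
    (theta : R) :
  immersion r -> no_silhouette theta r = clear_view (unroll r) theta.
Proof.
move=> ir; apply/seteqP; split=> P.
- move/(no_silhouetteE theta P ir) => ns t.
  by rewrite /sight derive1_unroll; exact: ns.
- by move=> ns; apply/no_silhouette_segment => // t _; exact: ns.
Qed.

(** * The aperture angle *)

Lemma no_silhouette_near (R : realType) (r : circle R -> R * R) (theta : R)
    (P : R * R) :
  immersion r -> no_silhouette theta r P ->
  \forall x \near theta, no_silhouette x r P.
Proof.
move=> ir /(no_silhouette_segment _ _ ir).
move/(clear_near (unroll_regular_loop ir)); apply: filterS => x ns.
exact/no_silhouette_segment.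
Qed.

Lemma no_silhouette_halfpi (R : realType) (r : circle R -> R * R) :
  immersion r -> no_silhouette (pi / 2) r = set0.
Proof.
move=> ir; rewrite no_silhouette_clear_view//; apply/seteqP; split=> // P ns.
have [t /eqP] := sight_halfpi_vanishes P (unroll_regular_loop ir).
by rewrite (negbTE (ns t)).
Qed.

Lemma aperture_candidates_neq0 (R : realType) (r : circle R -> R * R) :
  immersion r -> no_silhouette 0 r !=set0 -> aperture_candidates r !=set0.
Proof.
move=> ir [P nsP]; have pi0 := pi_gt0 R.
have /nbhs_ballP[d /= d0 dB] := no_silhouette_near ir nsP.
exists (Num.min d (pi / 2)); split.
  by rewrite lt_min d0 ge_min lexx orbT divr_gt0.
move=> t /andP[t0]; rewrite lt_min => /andP[td _].
by exists P; apply: dB; rewrite /ball /= sub0r normrN ger0_norm.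
Qed.

(** Below pi / 2, a point of the no-silhouette at the supremum would remain in the
no-silhouette at slightly larger angles, and the supremum could be exceeded. *)
Lemma no_silhouette_aperture (R : realType) (r : circle R -> R * R) :
  immersion r -> no_silhouette 0 r !=set0 ->
  no_silhouette (aperture_angle r) r = set0.
Proof.
move=> ir ns0.
have [] := aperture_angle_largest (aperture_candidates_neq0 ir ns0).
set a := aperture_angle r => -[/andP[a0 api] an] ub.
have [->|a_neq] := eqVneq a (pi / 2); first exact: no_silhouette_halfpi.
apply/seteqP; split=> // P nsP.
have /nbhs_ballP[d /= d0 dB] := no_silhouette_near ir nsP.
have pi0 := pi_gt0 R.
have amin : a < Num.min (a + d) (pi / 2).
  by rewrite lt_min ltrDl d0 lt_neqAle a_neq.
suff /ub : aperture_candidates r (Num.min (a + d) (pi / 2)).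
  by rewrite leNgt amin.
split; first by rewrite (lt_trans a0 amin) ge_min lexx orbT.
move=> t /andP[t0]; rewrite lt_min => /andP[td _].
have [ta|ta] := ltP t a; first by apply: an; rewrite t0.
exists P; apply: dB; rewrite /ball /= distrC ger0_norm ?subr_ge0//; lra.
Qed.

(** * Convergence to a point *)

Lemma limit_point_unique (R : realType) (A : nat -> set (R * R)) (P Q : R * R) :
  (forall i, A i !=set0) ->
  hausdorff_dist (closure (A i)) [set P] @[i --> \oo] --> 0%:E ->
  hausdorff_dist (closure (A i)) [set Q] @[i --> \oo] --> 0%:E ->
  P = Q.
Proof.
move=> A0 AP AQ; apply/eqP; rewrite -subr_eq0 -normr_eq0; apply: contraT => PQ.
have e0 : 0 < `|P - Q| / 2 by rewrite divr_gt0// lt_neqAle eq_sym PQ /=.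
have small X : hausdorff_dist (closure (A i)) [set X] @[i --> \oo] --> 0%:E ->
    \forall i \near \oo,
      (hausdorff_dist (closure (A i)) [set X] < (`|P - Q| / 2)%:E)%E.
  move=> AX; have nb : nbhs 0%:E [set y | (y < (`|P - Q| / 2)%:E)%E].
    apply: open_nbhs_nbhs; split; first exact: open_ereal_lt_ereal.
    by rewrite /= lte_fin.
  exact: AX _ nb.
have [i [iP iQ]] := filter_ex (filterI (small _ AP) (small _ AQ)).
have [x Ax] := A0 i.
have := ltrD (hausdorff_dist_point_lt Ax iP) (hausdorff_dist_point_lt Ax iQ).
rewrite -splitr distrC => /(le_lt_trans (ler_normD _ _)).
by rewrite addrA subrK ltxx.
Qed.

Theorem theorem2 (R : realType) (r : circle R -> R * R)
  (r_imm : immersion r) (r_ns : no_silhouette 0 r !=set0) :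
  exists! P : R * R,
    forall theta : nat -> R,
      (forall i : nat, 0 <= theta i < aperture_angle r) ->
      theta i @[i --> \oo] --> aperture_angle r ->
      hausdorff_dist (closure (no_silhouette (theta i) r)) [set P]
        @[i --> \oo] --> 0%:E.
Proof.
have rc := unroll_regular_loop r_imm.
have empty := no_silhouette_aperture r_imm r_ns.
have [] := aperture_angle_largest (aperture_candidates_neq0 r_imm r_ns).
move: empty; set a := aperture_angle r => empty [/andP[a0 api] an] _.
have pi0 := pi_gt0 R.
have sa : sin a != 0 by rewrite gt_eqF// sin_gt0_pi// a0 /=; lra.
(* Uniqueness of P requires at least one admissible sequence. *)
pose t0 (i : nat) := a - a * harmonic i.
have t0I i : 0 <= t0 i < a.
  rewrite subr_ge0 ltrBlDr ltrDl mulr_gt0 ?harmonic_gt0// andbT.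
  by rewrite ger_pMr// /harmonic /= invf_le1// ler1n.
have t0a : t0 i @[i --> \oo] --> a.
  rewrite -[X in _ --> X]subr0 -(mulr0 a); apply: cvgB; first exact: cvg_cst.
  by apply: cvgMl_tmp; exact: cvg_harmonic.
have [|A Aa|P HP] := @weak_view_shrinks _ (unroll r) a rc sa.
- by rewrite -no_silhouette_clear_view.
- have /filter_ex[i Ai] : \forall i \near \oo, A (t0 i) by exact: t0a.
  exists (t0 i) => //.
  have [Q] := an _ (t0I i); rewrite no_silhouette_clear_view// => nsQ.
  by exists Q; exact: clear_view_sub.
have limP (theta : nat -> R) : (forall i, 0 <= theta i < a) ->
    theta i @[i --> \oo] --> a ->
    hausdorff_dist (closure (no_silhouette (theta i) r)) [set P]
      @[i --> \oo] --> 0%:E.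
  move=> tI ta; apply: ereal_squeeze0 => e e0.
  have e20 : 0 < e / 2 by rewrite divr_gt0.
  have : \forall i \near \oo, forall Q, weak_view (unroll r) (theta i) Q ->
      `|Q - P| < e / 2.
    exact: ta _ (HP _ e20).
  apply: filterS => i near_P.
  rewrite [e]splitr; apply: hausdorff_dist_point_le; first exact: an.
  move=> x; rewrite no_silhouette_clear_view// => nsx.
  by apply/ltW/near_P; exact: clear_view_sub.
exists P; split=> // Q HQ.
apply: (limit_point_unique _ (limP _ t0I t0a) (HQ _ t0I t0a)) => i.
exact: an.
Qed.
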